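(* Let $p>0$ and $q\ge\max\{p,1\}$ be fixed, and let $R=R_n>0$ satisfy $R=o(1)$ as $n\to\infty$. Let $\mu=\sqrt{2\log(1/R^p)}$ and $s=\frac{nR^p}{\mu^p}$, and assume $s=\omega(1)$ (i.e. $s\to\infty$ as $n\to\infty$). For $\varepsilon\in(0,1)$, let $$v=(\sqrt{1-\varepsilon}\,\mu,\dots,\sqrt{1-\varepsilon}\,\mu,0,\dots,0)\in\mathbb{R}^n,\qquad\|v\|_0=\lfloor s\rfloor,$$ and let $\theta=(v_{\pi(1)},\dots,v_{\pi(n)})$ with $\pi\sim\mathrm{Unif}(S_n)$ (the permutation prior). Then the Bayes $\ell^q$ risk under this prior in the Gaussian sequence model $X\mid\theta\sim\mathcal{N}(\theta,I_n)$ satisfies $$\inf_{\widehat\theta}\mathbb{E}\left[\frac1n\sum_{i=1}^n|\widehat\theta_i(X)-\theta_i|^q\right]\ge(1-o(1))(1-c(\varepsilon))\,\mu^{q-p}R^p,$$ where, for each fixed $\varepsilon$, $o(1)\to0$ as $n\to\infty$, and $c(\varepsilon)\to0$ as $\varepsilon\to0^+$.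
   Context: The infimum is over all estimators (measurable functions) $\widehat\theta=\widehat\theta(X)$ of $X$, and the expectation is over the joint law of $(\theta,X)$, with $\theta$ drawn from the permutation prior. $S_n$ is the permutation group of $\{1,\dots,n\}$, and $\|v\|_0$ is the number of nonzero entries of $v$. The function $c$ does not depend on $n$. Logarithms are natural. *)

(* Defs.v *)
From HB Require Import structures.
From mathcomp Require Import all_boot all_order all_algebra perm.
From mathcomp Require Import all_classical all_reals all_analysis.
Set Implicit Arguments.
Unset Strict Implicit.
Unset Printing Implicit Defensive.
Import Order.TTheory GRing.Theory Num.Theory.
Import numFieldNormedType.Exports.
Local Open Scope classical_set_scope.
Local Open Scope ring_scope.

(* n.-tuple R carries the sigma-algebra generated by the n coordinates, i.e.
   the Borel sigma-algebra of R^n. *)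

Section cons_pair.
Context (R : realType) (n : nat).

Definition cons_pair (z : measurableTypeR R * n.-tuple (measurableTypeR R)) :
  n.+1.-tuple (measurableTypeR R) := [tuple of z.1 :: z.2].

Lemma measurable_cons_pair : measurable_fun [set: _] cons_pair.
Proof. exact: measurable_cons measurable_fst measurable_snd. Qed.

HB.instance Definition _ :=
  isMeasurableFun.Build _ _ _ _ cons_pair measurable_cons_pair.

End cons_pair.

(* N(theta, I_n): the product of the measures N(theta_i, 1), see
   gaussian_vectorE. *)
Fixpoint gaussian_vector (R : realType) (n : nat) :
    n.-tuple R -> probability (n.-tuple (measurableTypeR R)) R :=
  match n with
  | 0 => fun _ => \d_ [tuple]
  | m.+1 => fun theta =>
      distribution
        (normal_prob (thead theta) 1
           \x gaussian_vector [tuple of behead theta])%E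
        (@cons_pair R m)
  end.

Lemma gaussian_vectorE (R : realType) (n : nat) (theta : n.-tuple R)
    (A : 'I_n -> set (measurableTypeR R)) :
  (forall i, measurable (A i)) ->
  gaussian_vector theta [set x | forall i, A i (tnth x i)] =
  (\prod_(i < n) normal_prob (tnth theta i) 1 (A i))%E.
Proof.
elim: n theta A => [|n IHn] theta A mA /=.
  by rewrite big_ord0 diracE mem_set// => -[].
rewrite big_ord_recl /distribution /pushforward /=.
transitivity ((normal_prob (thead theta) 1 \x
    gaussian_vector [tuple of behead theta])%E
  (A ord0 `*` [set x : n.-tuple (measurableTypeR R) |
                 forall i, A (lift ord0 i) (tnth x i)])).
  congr (_ _); apply/seteqP; split=> -[a x] /=.
    move=> Aax; split; first exact: Aax ord0.
    by move=> i; have := Aax (lift ord0 i); rewrite tnthS.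
  move=> [Aa Ax] i; case: (unliftP ord0 i) => [j|] ->; last exact: Aa.
  by rewrite tnthS; exact: Ax.
rewrite product_measure1E//.
  rewrite [X in (_ * X)%E](_ : _ = \prod_(i < n)
      normal_prob (tnth [tuple of behead theta] i) 1 (A (lift ord0 i)))%E;
    last exact: IHn.
  congr (_ * _)%E; apply: eq_bigr => i _; congr (normal_prob _ _ _).
  by rewrite [in RHS](tuple_eta theta) tnthS.
rewrite (_ : [set _ | _] = \bigcap_(i in [set: 'I_n])
    ((fun x : n.-tuple (measurableTypeR R) => tnth x i) @^-1`
      A (lift ord0 i))); last first.
  by apply/seteqP; split=> x /= Ax i; [move=> _|]; exact: Ax.
apply: fin_bigcap_measurable => // i _.
by rewrite -[X in measurable X]setTI; exact: measurable_tnth.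
Qed.

Section sequence_model.
Context {R : realType}.

(* The threshold mu attached to the radius r = R_n. *)
Definition mu (p r : R) : R := Num.sqrt (2 * ln (1 / r `^ p)).

Definition sparsity (p : R) (n : nat) (r : R) : R :=
  n%:R * r `^ p / mu p r `^ p.

(* Num.truncn is the floor here, as the sparsity is nonnegative. *)
Definition spike_vector (p eps : R) (n : nat) (r : R) : n.-tuple R :=
  [tuple if (i < Num.truncn (sparsity p n r))%N
         then Num.sqrt (1 - eps) * mu p r else 0 | i < n].

Definition permute (n : nat) (v : n.-tuple R) (s : 'S_n) : n.-tuple R :=
  [tuple tnth v (s i) | i < n].

Definition lq_loss (q : R) (n : nat) (t theta : n.-tuple R) : R :=
  n%:R^-1 * \sum_(i < n) `|tnth t i - tnth theta i| `^ q.

Local Notation "''R^' n" := (n.-tuple (measurableTypeR R))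
  (at level 8, n at level 2).

(* Expected loss of the estimator t under the joint law of (theta, X): the
   average over the n! equiprobable permutations s of the conditional
   expectation given theta = permute v s, where X ~ N(theta, I_n). *)
Definition permutation_risk (q : R) (n : nat) (v : n.-tuple R)
    (t : 'R^n -> 'R^n) : \bar R :=
  ((n`!%:R^-1)%:E * \sum_(s : 'S_n)
    \int[gaussian_vector (permute v s)]_x
      (lq_loss q (t x) (permute v s))%:E)%E.

Definition permutation_bayes_risk (q : R) (n : nat) (v : n.-tuple R) : \bar R :=
  ereal_inf [set permutation_risk q v t | t in
    [set t : 'R^n -> 'R^n | measurable_fun [set: 'R^n] t]].

End sequence_model.

(* Main.v *)
(* Write k for the number of spikes, a for their height, and L_j for the
   likelihood ratio exp (a X_j - a^2/2) of coordinate j. Reveal the positions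
   of k - 1 of the k spikes. After exchanging labels, and under the pure noise
   measure, the risk is an average of terms
     (revealed L's) * (k |t_i - a|^q L_i + |t_i|^q sum_j L_j),
   where i is the hidden spike and j runs over the n - k null coordinates, so
   that each term is at least (1 - tau)^q a^q k min (L_i, (tau^q / k) sum_j L_j)
   up to the revealed factors. Truncating each L_j at a level A makes the second
   moment of the sum at most A times the first one, so a second-moment bound
   shows that the minimum has expectation close to the truncated mean e of L_i.
   Since a^2/2 = (1 - eps) mu^2/2 stays below log A, which is mu^2/2 up to a
   constant, e tends to 1, and the risk of the zero estimator, about
   k a^q / n = (1 - eps)^(q/2) mu^(q-p) R^p, is asymptotically optimal. *)

Require Import Defs.
From mathcomp Require Import all_boot all_order all_algebra perm ring lra.
From mathcomp Require Import all_classical all_reals all_analysis.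
From mathcomp Require Import measurable_realfun.
Set Implicit Arguments.
Unset Strict Implicit.
Unset Printing Implicit Defensive.
Import Order.TTheory GRing.Theory Num.Theory.
Import numFieldNormedType.Exports.
Local Open Scope classical_set_scope.
Local Open Scope ring_scope.

(** * Gaussian densities, changes of measure and independence of coordinates *)

Section gaussian_integrals.
Context {R : realType}.
Local Notation T := (measurableTypeR R).
Local Notation leb := (@lebesgue_measure R).
Implicit Types (b c : R) (n : nat).

(** The Radon-Nikodym derivative and [normal_pdf] have equal integrals over every measurable set,
    hence agree almost everywhere. *)
Lemma ge0_integral_normal_prob b (s : R) (f : T -> \bar R) :
  measurable_fun [set: T] f -> (forall x, 0 <= f x)%E ->
  (\int[normal_prob b s]_x f x = \int[leb]_x (f x * (normal_pdf b s x)%:E))%E.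
Proof.
move=> mf f0; have dom := normal_prob_dominates b s.
rewrite -(Radon_Nikodym_SigmaFinite.change_of_variables dom)//.
have iRN := Radon_Nikodym_SigmaFinite.f_integrable dom.
have mpdf : measurable_fun [set: T] (fun x => (normal_pdf b s x)%:E).
  by apply/measurable_EFinP; exact: measurable_normal_pdf.
apply: ae_eq_integral => //.
- by apply: emeasurable_funM => //; exact: (measurable_int leb).
- exact: emeasurable_funM.
- apply: ae_eqe_mul2l; apply: integral_ae_eq => //.
  by move=> E _ mE; rewrite -Radon_Nikodym_SigmaFinite.f_integral.
Qed.

(** The density of N(c, 1) with respect to N(b, 1). *)
Definition gauss_lr b c (x : R) : R := expR ((c - b) * x - (c ^+ 2 - b ^+ 2) / 2).

Lemma measurable_gauss_lr b c : measurable_fun [set: T] (gauss_lr b c).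
Proof.
by apply: measurableT_comp => //; exact: measurable_funB.
Qed.

Lemma normal_pdf_lr b c x :
  normal_pdf c 1 x = gauss_lr b c x * normal_pdf b 1 x.
Proof.
rewrite !normal_pdfE ?oner_eq0// mulrCA; congr (_ * _).
by rewrite /normal_fun /gauss_lr -expRD; congr expR; rewrite expr1n; field.
Qed.

Lemma ge0_integral_normal_lr b c (f : T -> \bar R) :
  measurable_fun [set: T] f -> (forall x, 0 <= f x)%E ->
  (\int[normal_prob c 1]_x f x
   = \int[normal_prob b 1]_x (f x * (gauss_lr b c x)%:E))%E.
Proof.
move=> mf f0; rewrite !ge0_integral_normal_prob//; last 2 first.
- apply: emeasurable_funM => //; apply/measurable_EFinP.
  exact: measurable_gauss_lr.
- by move=> x; rewrite mule_ge0// lee_fin expR_ge0.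
by apply: eq_integral => x _; rewrite -muleA -EFinM -normal_pdf_lr.
Qed.

Lemma ge0_integral_gaussian_vectorS n (theta : n.+1.-tuple R)
    (f : n.+1.-tuple T -> \bar R) :
  measurable_fun [set: n.+1.-tuple T] f -> (forall x, 0 <= f x)%E ->
  (\int[gaussian_vector theta]_x f x =
   \int[normal_prob (thead theta) 1]_y
     \int[gaussian_vector [tuple of behead theta]]_z f (cons_pair (y, z)))%E.
Proof.
move=> mf f0 /=.
rewrite ge0_integral_pushforward//= preimage_setT fubini_tonelli1//.
by apply: measurableT_comp => //; exact: measurable_cons_pair.
Qed.

(** By induction on [n] through Tonelli: the induction hypothesis changes the law of the tail inside
    the inner integral, and the one-dimensional change of measure then treats the first
    coordinate. *)
Lemma ge0_integral_gaussian_vector_lr n (theta theta' : n.-tuple R)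
    (f : n.-tuple T -> \bar R) :
  measurable_fun [set: n.-tuple T] f -> (forall x, 0 <= f x)%E ->
  (\int[gaussian_vector theta']_x f x =
   \int[gaussian_vector theta]_x
     (f x * (\prod_(i < n)
              gauss_lr (tnth theta i) (tnth theta' i) (tnth x i))%:E))%E.
Proof.
elim: n theta theta' f => [|n IHn] theta theta' f mf f0.
  rewrite /=; apply: eq_integral => x _.
  by rewrite big_ord0 mule1.
have mcons y : measurable_fun [set: n.-tuple T] (fun z => cons_pair (y, z)).
  apply: measurableT_comp; first exact: measurable_cons_pair.
  exact: measurable_pair1.
have mprod m (t t' : m.-tuple R) : measurable_fun [set: m.-tuple T]
    (fun x => \prod_(i < m) gauss_lr (tnth t i) (tnth t' i) (tnth x i)).
  apply: measurable_prod => i _.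
  apply: measurableT_comp; first exact: measurable_gauss_lr.
  exact: measurable_tnth.
have prod0 m (t t' x : m.-tuple R) :
    0 <= \prod_(i < m) gauss_lr (tnth t i) (tnth t' i) (tnth x i).
  by apply: prodr_ge0 => i _; exact: expR_ge0.
apply: (etrans (ge0_integral_gaussian_vectorS theta' mf f0)).
apply/esym/(etrans (@ge0_integral_gaussian_vectorS _ theta _ _ _)).
- by apply: emeasurable_funM => //; apply/measurable_EFinP; exact: mprod.
- by move=> x; rewrite mule_ge0// lee_fin; exact: prod0.
pose b := [tuple of behead theta]; pose b' := [tuple of behead theta'].
apply/esym; have -> : (fun y => \int[gaussian_vector b']_z f (cons_pair (y, z)))%E =
    (fun y => \int[gaussian_vector b]_z (f (cons_pair (y, z)) *
       (\prod_(i < n) gauss_lr (tnth b i) (tnth b' i) (tnth z i))%:E))%E.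
  apply/funext => y; apply: IHn => //.
  exact: (measurableT_comp mf).
move: (gaussian_vector b) => P.
pose h (z : T * n.-tuple T) := (f (cons_pair z) *
  (\prod_(i < n) gauss_lr (tnth b i) (tnth b' i) (tnth z.2 i))%:E)%E.
have mh : measurable_fun [set: T * n.-tuple T] h.
  apply: emeasurable_funM.
    by apply: measurableT_comp => //; exact: measurable_cons_pair.
  apply/measurable_EFinP.
  exact: (measurableT_comp (mprod _ b b') measurable_snd).
have h0 z : (0 <= h z)%E by rewrite mule_ge0// lee_fin; exact: prod0.
have mF := @measurable_fun_fubini_tonelli_F _ _ T (n.-tuple T) R P h mh h0.
rewrite (ge0_integral_normal_lr (thead theta) _ mF); last first.
  by move=> y; apply: integral_ge0 => z _; exact: h0.
apply: eq_integral => y _.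
rewrite /fubini_F muleC -ge0_integralZl//; last 2 first.
- by apply: (measurableT_comp mh); exact: measurable_pair1.
- by rewrite lee_fin expR_ge0.
apply: eq_integral => z _; rewrite /h.
rewrite muleCA; congr (_ * _)%E; rewrite -EFinM big_ord_recl; congr (_ * _)%:E.
have tnth_lift (t : n.+1.-tuple R) i :
    tnth t (lift ord0 i) = tnth [tuple of behead t] i.
  by rewrite [in LHS](tuple_eta t) tnthS.
by apply: eq_bigr => i _; rewrite (tnth_lift theta) (tnth_lift theta') tnthS.
Qed.

Lemma ge0_integral_gaussian_vector_prod n (theta : n.-tuple R)
    (f : 'I_n -> T -> R) :
  (forall i, measurable_fun [set: T] (f i)) -> (forall i x, 0 <= f i x) ->
  (\int[gaussian_vector theta]_x (\prod_(i < n) f i (tnth x i))%:E =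
   \prod_(i < n) \int[normal_prob (tnth theta i) 1]_y (f i y)%:E)%E.
Proof.
have mprod m (g : 'I_m -> T -> R) : (forall i, measurable_fun [set: T] (g i)) ->
    measurable_fun [set: m.-tuple T] (fun x => \prod_(i < m) g i (tnth x i)).
  move=> mg; apply: measurable_prod => i _.
  by apply: (measurableT_comp (mg i)); exact: measurable_tnth.
elim: n theta f => [|n IHn] theta f mf f0.
  rewrite /= integral_dirac//; last by apply/measurable_EFinP; exact: mprod.
  by rewrite diracE mem_set// mul1e !big_ord0.
pose g (x : n.+1.-tuple T) := (\prod_(i < n.+1) f i (tnth x i))%:E.
have mg : measurable_fun [set: n.+1.-tuple T] g.
  by apply/measurable_EFinP; exact: mprod.
have g0 x : (0 <= g x)%E by rewrite lee_fin prodr_ge0.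
apply: (etrans (ge0_integral_gaussian_vectorS theta mg g0)).
set b := [tuple of behead theta].
transitivity (\int[normal_prob (thead theta) 1]_y ((f ord0 y)%:E *
    \prod_(i < n) \int[normal_prob (tnth b i) 1]_z (f (lift ord0 i) z)%:E))%E.
  apply: eq_integral => y _.
  rewrite -IHn// -ge0_integralZl//; last 3 first.
  - by apply/measurable_EFinP; exact: (mprod n (fun i => f (lift ord0 i))).
  - by move=> z _; rewrite lee_fin prodr_ge0.
  - by rewrite lee_fin.
  apply: eq_integral => z _; rewrite -EFinM /g big_ord_recl; congr (_ * _)%:E.
  by apply: eq_bigr => i _; rewrite tnthS.
rewrite ge0_integralZr//; last 3 first.
- exact/measurable_EFinP.
- by move=> y _; rewrite lee_fin.
- by apply: prode_ge0 => i _; apply: integral_ge0 => y _; rewrite lee_fin.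
have lift_behead :
    (\prod_(i < n) \int[normal_prob (tnth theta (lift ord0 i)) 1]_y
       (f (lift ord0 i) y)%:E =
     \prod_(i < n) \int[normal_prob (tnth b i) 1]_y (f (lift ord0 i) y)%:E)%E.
  apply: eq_bigr => i _.
  rewrite (_ : tnth b i = tnth theta (lift ord0 i)) //.
  by rewrite [in RHS](tuple_eta theta) tnthS.
rewrite -lift_behead.
by rewrite big_ord_recl.
Qed.

End gaussian_integrals.

(** * Second-moment lower bound for the truncated likelihood ratios *)

(** With [w = S / B], the claim is that [x * (2 * w - w ^+ 2)] is below both arguments of the
    minimum: below [x] because [(1 - w) ^+ 2 >= 0], and below [h * S] because it is at most
    [2 * A * w <= h * B * w]. The expectation of such a bound only involves two moments of [S]. *)
Lemma min_ge_quadratic (R : realFieldType) (x S h A B : R) :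
  0 <= x <= A -> 0 <= S -> 0 < B -> 2 * A <= h * B ->
  2 / B * (x * S) <= Num.min x (h * S) + B ^- 2 * (x * S ^+ 2).
Proof.
move=> /andP[x0 xA] S0 B0 AhB; have B_neq0 : B != 0 by rewrite gt_eqF.
have [w Sw w0] : exists2 w, S = w * B & 0 <= w.
  by exists (S / B); [rewrite divfK | rewrite divr_ge0 ?(ltW B0)].
rewrite Sw (_ : 2 / B * _ = x * (2 * w)); last by field.
rewrite (_ : B ^- 2 * _ = x * w ^+ 2); last by field.
rewrite -lerBlDr -mulrBr le_min; apply/andP; split.
  rewrite -[leRHS]mulr1 ler_wpM2l// -subr_ge0.
  by rewrite (_ : _ - _ = (1 - w) ^+ 2) ?sqr_ge0//; ring.
apply: (@le_trans _ _ (A * (2 * w))).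
  apply: (@le_trans _ _ (x * (2 * w))); first by rewrite ler_wpM2l ?gerBl ?sqr_ge0.
  by rewrite ler_wpM2r ?mulr_ge0.
rewrite (_ : A * _ = w * (2 * A)); last by ring.
by rewrite (_ : h * _ = w * (h * B)) ?ler_wpM2l//; ring.
Qed.

Section conditional_big.
Context d (T : measurableType d) (R : realType) (I : eqType).
Implicit Types (s : seq I) (P : pred I) (f : I -> T -> R).

Lemma measurable_prod_cond s P f :
  (forall i, measurable_fun [set: T] (f i)) ->
  measurable_fun [set: T] (fun x => \prod_(i <- s | P i) f i x).
Proof.
move=> mf; under eq_fun do rewrite big_mkcond.
by apply: measurable_prod => i _; case: (P i).
Qed.

Lemma measurable_sum_cond s P f :
  (forall i, measurable_fun [set: T] (f i)) ->
  measurable_fun [set: T] (fun x => \sum_(i <- s | P i) f i x).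
Proof.
move=> mf; under eq_fun do rewrite big_mkcond.
by apply: measurable_sum => i; case: (P i).
Qed.

Lemma ge0_integral_sum_cond (mu : {measure set T -> \bar R}) s P f :
  (forall i, measurable_fun [set: T] (f i)) -> (forall i x, 0 <= f i x) ->
  (\int[mu]_x (\sum_(i <- s | P i) f i x)%:E =
   \sum_(i <- s | P i) \int[mu]_x (f i x)%:E)%E.
Proof.
move=> mf f0.
under eq_integral do rewrite -sumEFin -big_filter.
rewrite ge0_integral_sum//; last 2 first.
- by move=> i; exact/measurable_EFinP.
- by move=> i x _; rewrite lee_fin.
by rewrite big_filter.
Qed.

End conditional_big.

Section truncated_likelihood.
Context {R : realType}.
Local Notation T := (measurableTypeR R).

Lemma integral_gauss_lr (b c : R) :
  (\int[normal_prob b 1]_x (gauss_lr b c x)%:E = 1)%E.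
Proof.
transitivity (\int[normal_prob c 1]_x cst 1%E x)%E.
  apply/esym; apply: (etrans (@ge0_integral_normal_lr _ b c (cst 1%E) _ _)) => //.
  by apply: eq_integral => x _; rewrite mul1e.
by rewrite integral_cst// mul1e; exact: probability_setT.
Qed.

Lemma ge0_integral_gaussian_vector_prod_perm n (theta : n.-tuple R) (u : 'S_n)
    (g : 'I_n -> T -> R) :
  (forall i, measurable_fun [set: T] (g i)) -> (forall i x, 0 <= g i x) ->
  (\int[gaussian_vector theta]_x (\prod_(i < n) g i (tnth x (u i)))%:E =
   \prod_(i < n) \int[normal_prob (tnth theta (u i)) 1]_y (g i y)%:E)%E.
Proof.
move=> mg g0.
transitivity (\int[gaussian_vector theta]_x
    (\prod_(i < n) g ((u^-1)%g i) (tnth x i))%:E)%E.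
  apply: eq_integral => x _; congr EFin.
  rewrite [RHS](reindex_inj (@perm_inj _ u)).
  by apply: eq_bigr => i _; rewrite permK.
apply: (etrans (@ge0_integral_gaussian_vector_prod _ _ theta
  (fun i => g ((u^-1)%g i)) _ _)) => [i|i x|]; [exact: mg|exact: g0|].
rewrite [LHS](reindex_inj (@perm_inj _ u)).
by apply: eq_bigr => i _; rewrite permK.
Qed.

(** Position [c] sits at coordinate [u c]. Positions before [z] are the revealed spikes, [z] is the
    hidden spike and later positions are null. The truncated ratio enters only through its range
    [[0, A]] and its mean [e] under pure noise. *)
Variables (n : nat) (u : 'S_n) (z : 'I_n) (a A e : R) (M : T -> R).
Hypotheses (mM : measurable_fun [set: T] M) (M0 : forall x, 0 <= M x).
Hypothesis MA : forall x, M x <= A.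
Hypothesis eM : (\int[normal_prob 0 1]_x (M x)%:E = e%:E)%E.

Let P0 := gaussian_vector [tuple of nseq n (0 : R)].
Let L (x : n.-tuple T) := \prod_(c < n | (c < z)%N) gauss_lr 0 a (tnth x (u c)).
Let Md (d : 'I_n) (x : n.-tuple T) := M (tnth x (u d)).
Let Q (D : {set 'I_n}) x := L x * \prod_(c in D) Md c x.

Let measurable_coord (f : T -> R) c : measurable_fun [set: T] f ->
  measurable_fun [set: n.-tuple T] (fun x => f (tnth x (u c))).
Proof. by move=> mf; apply: (measurableT_comp mf); exact: measurable_tnth. Qed.

Let measurable_L : measurable_fun [set: n.-tuple T] L.
Proof.
apply: measurable_prod_cond => c.
by apply: (@measurable_coord (gauss_lr 0 a)); exact: measurable_gauss_lr.
Qed.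

Let L_ge0 x : 0 <= L x.
Proof. by apply: prodr_ge0 => c _; exact: expR_ge0. Qed.

Let measurable_Md d : measurable_fun [set: n.-tuple T] (Md d).
Proof. exact: measurable_coord. Qed.

Let measurable_Q D : measurable_fun [set: n.-tuple T] (Q D).
Proof. by apply: measurable_funM => //; exact: measurable_prod_cond. Qed.

Let Q_ge0 D x : 0 <= Q D x.
Proof. by rewrite mulr_ge0// prodr_ge0// => c _; exact: M0. Qed.

(** By independence, each revealed likelihood ratio integrates to 1 and each factor indexed by [D]
    to [e]; the condition on [D] keeps the two groups of coordinates disjoint. *)
Let integral_Q (D : {set 'I_n}) : (forall c, c \in D -> (z <= c)%N) ->
  (\int[P0]_x (Q D x)%:E = (e ^+ #|D|)%:E)%E.
Proof.
move=> zD.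
pose g (c : 'I_n) (y : T) :=
  (if (c < z)%N then gauss_lr 0 a y else 1) * (if c \in D then M y else 1).
have mg c : measurable_fun [set: T] (g c).
  apply: measurable_funM; last by case: (c \in D).
  by case: (c < z)%N => //; exact: measurable_gauss_lr.
have g0 c y : 0 <= g c y.
  by rewrite mulr_ge0//; case: ifPn => // _; exact: expR_ge0.
transitivity (\int[P0]_x (\prod_(c < n) g c (tnth x (u c)))%:E)%E.
  apply: eq_integral => x _; congr EFin.
  by rewrite big_split/= -!big_mkcond.
rewrite ge0_integral_gaussian_vector_prod_perm//.
rewrite -prodr_const -prodEFin [RHS]big_mkcond/=; apply: eq_bigr => c _.
rewrite tnth_nseq.
case: ifPn => cD.
  rewrite -eM; apply: eq_integral => y _.
  by rewrite /g cD ltnNge (zD _ cD) mul1r.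
have [cz|cz] := ltnP c z.
  rewrite -(integral_gauss_lr 0 a); apply: eq_integral => y _.
  by rewrite /g cz (negbTE cD) mulr1.
transitivity (\int[normal_prob (0 : R)%R 1]_x cst 1%E x)%E.
  by apply: eq_integral => y _; rewrite /g ltnNge cz (negbTE cD) mulr1.
by rewrite integral_cst// mul1e; exact: probability_setT.
Qed.

(** [min_ge_quadratic] is integrated with [B = N * e], the mean of the sum over null positions. The
    linear term gives [2 * e], and the quadratic one costs at most [(1 - 1 / N) * e + A / N]. *)
Lemma integral_min_truncated_ge (h : R) :
  let N : R := (n - z.+1)%:R in
  0 < N -> 0 < e -> 2 * A <= h * (N * e) ->
  ((e - A / N)%:E <= \int[gaussian_vector [tuple of nseq n 0%R]]_x
     (\prod_(c < n | (c < z)%N) gauss_lr 0 a (tnth x (u c)) *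
      Num.min (M (tnth x (u z)))
              (h * \sum_(d < n | (z < d)%N) M (tnth x (u d))))%:E)%E.
Proof.
move=> N N0 e0 Ah.
pose B := N * e; have B0 : 0 < B by rewrite mulr_gt0.
have A0 : 0 <= A by rewrite (le_trans (M0 0)).
have h0 : 0 <= h.
  by rewrite -(pmulr_lge0 _ B0) (le_trans _ Ah)// mulr_ge0.
pose S x := \sum_(d < n | (z < d)%N) Md d x.
have S0 x : 0 <= S x by rewrite sumr_ge0// => d _; exact: M0.
have mS : measurable_fun [set: n.-tuple T] S.
  by apply: measurable_sum_cond => d; exact: measurable_Md.
have cardN : (\sum_(d < n | (z < d)%N) 1 = N)%R.
  rewrite /N -(muln1 (n - z.+1)%N) -sum_nat_const_nat natr_sum.
  by rewrite (big_nat_widenl _ 0)// big_mkord.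
(* Expanding [M_z S] gives the terms [Q1], and the off-diagonal part of [M_z S ^ 2] the terms [Q2],
   each weighted by the revealed factors. They are products over 2 and 3 distinct positions, whence
   [e ^+ 2] and [e ^+ 3]. *)
pose Q1 (d : 'I_n) := Q [set z; d].
pose Q2 (d d' : 'I_n) := Q [set z; d; d'].
have iQ1 (d : 'I_n) : (z < d)%N -> (\int[P0]_x (Q1 d x)%:E = (e ^+ 2)%:E)%E.
  move=> zd; rewrite integral_Q.
    by rewrite cards2 (_ : z != d)// -val_eqE/= ltn_eqF.
  by move=> c; rewrite !inE => /orP[] /eqP-> //; exact: ltnW.
have iQ2 (d d' : 'I_n) : (z < d)%N -> (z < d')%N -> d' != d ->
    (\int[P0]_x (Q2 d d' x)%:E = (e ^+ 3)%:E)%E.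
  move=> zd zd' dd'; rewrite integral_Q.
    rewrite finset.setUC cardsU1 cards2 !inE negb_or dd' andbT.
    by rewrite -!val_eqE/= (gtn_eqF zd') (ltn_eqF zd).
  by move=> c; rewrite !inE => /orP[/orP[]|] /eqP-> //; exact: ltnW.
pose G x := L x * Num.min (Md z x) (h * S x).
have G0 x : 0 <= G x.
  by rewrite mulr_ge0// le_min M0 mulr_ge0.
have mG : measurable_fun [set: n.-tuple T] G.
  apply: measurable_funM => //; apply: measurable_minr => //.
  exact: measurable_funM.
pose C x := \sum_(d < n | (z < d)%N)
  \sum_(d' < n | (z < d')%N && (d' != d)) Q2 d d' x.
pose D x := \sum_(d < n | (z < d)%N) Q1 d x.
have Q1E (d : 'I_n) x : (z < d)%N -> Q1 d x = L x * (Md z x * Md d x).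
  move=> zd; rewrite /Q1 /Q big_setU1/= ?big_set1// inE.
  by rewrite -val_eqE/= ltn_eqF.
have Q2E (d d' : 'I_n) x : (z < d)%N -> (z < d')%N -> d' != d ->
    Q2 d d' x = L x * (Md z x * (Md d x * Md d' x)).
  move=> zd zd' dd'; rewrite /Q2 /Q finset.setUC big_setU1 ?inE ?negb_or/=.
    rewrite big_setU1/= ?big_set1 ?inE; last by rewrite -val_eqE/= ltn_eqF.
    by congr (_ * _); rewrite mulrC mulrA.
  by rewrite dd' andbT -val_eqE/= gtn_eqF.
have LMS x : L x * (Md z x * S x) = D x.
  by rewrite /S !mulr_sumr; apply: eq_bigr => d zd; rewrite Q1E.
(* The diagonal terms satisfy M_d ^ 2 <= A M_d. *)
have LMS2 x : L x * (Md z x * S x ^+ 2) <= C x + A * D x.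
  rewrite /C /D mulr_sumr -big_split/=.
  rewrite expr2 mulr_suml !mulr_sumr ler_sum// => d zd.
  rewrite {1}/S (bigD1 d)//= mulrDr !mulrDr addrC lerD//.
    rewrite Q1E// [leRHS](_ : _ = L x * (Md z x * (Md d x * A))); last by ring.
    by rewrite !ler_wpM2l//; [exact: M0|exact: M0|exact: MA].
  rewrite !mulr_sumr; apply: ler_sum => d' /andP[zd' dd'].
  by rewrite Q2E.
have key x : 2 / B * D x <= G x + B ^- 2 * (C x + A * D x).
  have /(ler_wpM2l (L_ge0 x)) : 2 / B * (Md z x * S x) <=
      Num.min (Md z x) (h * S x) + B ^- 2 * (Md z x * S x ^+ 2).
    by apply: (min_ge_quadratic (A := A)) => //; rewrite M0 MA.
  rewrite mulrDr mulrCA LMS => /le_trans; apply.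
  by rewrite lerD2l mulrCA ler_wpM2l// invr_ge0 sqr_ge0.
have mQ1 d : measurable_fun [set: n.-tuple T] (Q1 d) by exact: measurable_Q.
have mQ2 d d' : measurable_fun [set: n.-tuple T] (Q2 d d') by exact: measurable_Q.
have mD : measurable_fun [set: n.-tuple T] D by exact: measurable_sum_cond.
have mC : measurable_fun [set: n.-tuple T] C.
  by apply: measurable_sum_cond => d; exact: measurable_sum_cond.
have D0 x : 0 <= D x by rewrite sumr_ge0// => d _; exact: Q_ge0.
have C0 x : 0 <= C x.
  by rewrite sumr_ge0// => d _; rewrite sumr_ge0// => d' _; exact: Q_ge0.
have iD : (\int[P0]_x (D x)%:E = (N * e ^+ 2)%:E)%E.
  rewrite ge0_integral_sum_cond//; last by move=> d x; exact: Q_ge0.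
  under eq_bigr => d zd do rewrite iQ1//.
  by rewrite sumEFin -cardN mulr_suml; under [in RHS]eq_bigr do rewrite mul1r.
have iC : (\int[P0]_x (C x)%:E = (N * ((N - 1) * e ^+ 3))%:E)%E.
  rewrite ge0_integral_sum_cond//; last 2 first.
  - by move=> d; exact: measurable_sum_cond.
  - by move=> d x; rewrite sumr_ge0// => d' _; exact: Q_ge0.
  rewrite -[in RHS]cardN mulr_suml -sumEFin; apply: eq_bigr => d zd.
  rewrite ge0_integral_sum_cond//; last by move=> d' x; exact: Q_ge0.
  under eq_bigr => d' /andP[zd' dd'] do rewrite iQ2//.
  rewrite sumEFin mul1r [in RHS](bigD1 d)//= addrAC subrr add0r mulr_suml.
  by under [in RHS]eq_bigr do rewrite mul1r.
have B2 : 0 <= B ^- 2 by rewrite invr_ge0 sqr_ge0.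
have mCD : measurable_fun [set: n.-tuple T] (fun x => C x + A * D x).
  by apply: measurable_funD => //; exact: measurable_funM.
have CD0 x : 0 <= C x + A * D x by rewrite addr_ge0// mulr_ge0.
have iCD : (\int[P0]_x (B ^- 2 * (C x + A * D x))%:E =
    (B ^- 2 * (N * ((N - 1) * e ^+ 3) + A * (N * e ^+ 2)))%:E)%E.
  under eq_integral do rewrite EFinM.
  rewrite ge0_integralZl_EFin//; last 2 first.
  - by move=> x _; rewrite lee_fin.
  - exact/measurable_EFinP.
  under eq_integral do rewrite EFinD EFinM.
  rewrite ge0_integralD//; last 4 first.
  - by move=> x _; rewrite lee_fin.
  - exact/measurable_EFinP.
  - by move=> x _; rewrite mule_ge0// lee_fin.
  - by apply: emeasurable_funM => //; exact/measurable_EFinP.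
  rewrite ge0_integralZl_EFin//; last 2 first.
  - by move=> x _; rewrite lee_fin.
  - exact/measurable_EFinP.
  by rewrite iD iC.
have : (\int[P0]_x (2 / B * D x)%:E <=
    \int[P0]_x ((G x)%:E + (B ^- 2 * (C x + A * D x))%:E))%E.
  apply: ge0_le_integral => //.
  - by move=> x _; rewrite lee_fin mulr_ge0// divr_ge0// ltW.
  - by apply/measurable_EFinP; exact: measurable_funM.
  - apply/measurable_EFinP; apply: measurable_funD => //.
    exact: measurable_funM.
  - by move=> x _; rewrite -EFinD lee_fin.
rewrite ge0_integralD//; last 4 first.
- by move=> x _; rewrite lee_fin.
- exact/measurable_EFinP.
- by move=> x _; rewrite lee_fin mulr_ge0.
- by apply/measurable_EFinP; exact: measurable_funM.
rewrite iCD -leeBlDr//; apply: le_trans.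
under eq_integral do rewrite EFinM.
rewrite ge0_integralZl_EFin//; last 3 first.
- by move=> x _; rewrite lee_fin.
- exact/measurable_EFinP.
- by rewrite divr_ge0// ltW.
rewrite iD -EFinM -EFinB lee_fin -subr_ge0.
(* The diagonal is missing from [C], which has [N * (N - 1)] terms; this leaves a surplus [e / N],
   which is discarded. *)
rewrite (_ : _ - _ = e / N) ?divr_ge0 ?(ltW e0) ?(ltW N0)//.
by rewrite /B; field; rewrite !gt_eqF.
Qed.

End truncated_likelihood.

(** * Exchange of labels, the two-point bound and the resulting risk bound *)

(** Exchanging a spike position with [z] preserves the product of the [l], so the spikes give [z.+1]
    equal terms. Exchanging a null position [c] with [z] instead trades the factor [l (u z)] for
    [l (u c)]. *)
Lemma sum_perm_spike (R : comNzRingType) n (z : 'I_n) (l F G : 'I_n -> R) :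
  \sum_(u : 'S_n) (\sum_(c < n) (if (c <= z)%N then F (u c) else G (u c))) *
                  \prod_(c < n | (c <= z)%N) l (u c) =
  \sum_(u : 'S_n) \prod_(c < n | (c < z)%N) l (u c) *
    (z.+1%:R * (F (u z) * l (u z)) +
     G (u z) * \sum_(d < n | (z < d)%N) l (u d)).
Proof.
have prod_le (u : 'S_n) : \prod_(c < n | (c <= z)%N) l (u c) =
    \prod_(c < n | (c < z)%N) l (u c) * l (u z).
  rewrite (bigD1 z)//= mulrC; congr (_ * _); apply: eq_bigl => c.
  by rewrite ltn_neqAle andbC.
(* Exchange the labels c and z. *)
have F_sym (c : 'I_n) : (c <= z)%N ->
    \sum_(u : 'S_n) F (u c) * \prod_(c' < n | (c' <= z)%N) l (u c') =
    \sum_(u : 'S_n) F (u z) * \prod_(c' < n | (c' <= z)%N) l (u c').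
  move=> cz; rewrite (reindex_inj (mulgI (tperm c z))).
  apply: eq_bigr => u _; rewrite permM tpermL; congr (_ * _).
  rewrite [RHS](reindex_inj (@perm_inj _ (tperm c z))).
  apply: eq_big => [c'|c' _]; last by rewrite permM.
  by case: tpermP => [->|->|//]; rewrite ?cz ?leqnn.
have G_sym (c : 'I_n) : (z < c)%N ->
    \sum_(u : 'S_n) G (u c) * \prod_(c' < n | (c' <= z)%N) l (u c') =
    \sum_(u : 'S_n) \prod_(c < n | (c < z)%N) l (u c) * (G (u z) * l (u c)).
  move=> zc; rewrite (reindex_inj (mulgI (tperm c z))).
  apply: eq_bigr => u _; rewrite prod_le !permM tpermL tpermR mulrCA.
  congr (_ * _); apply: eq_bigr => c' c'z; rewrite permM tpermD//.
    by rewrite -val_eqE/= gtn_eqF// (ltn_trans c'z).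
  by rewrite -val_eqE/= gtn_eqF.
under eq_bigr do rewrite mulr_suml.
rewrite exchange_big/= (bigID (fun c : 'I_n => (c <= z)%N))/=.
under [in X in X + _]eq_bigr => c cz do
  (under eq_bigr do rewrite cz; rewrite F_sym//).
under [in X in _ + X]eq_bigr => c cz do
  (under eq_bigr do rewrite (negbTE cz); rewrite -ltnNge in cz; rewrite G_sym//).
have card_le : \sum_(c < n | (c <= z)%N) 1 = z.+1%:R :> R.
  rewrite -[in RHS](subn0 z.+1) -(muln1 (z.+1 - 0)%N) -sum_nat_const_nat.
  by rewrite natr_sum (big_nat_widen _ _ n)// big_mkord.
under [RHS]eq_bigr do rewrite mulrDr mulrCA mulr_sumr mulr_sumr.
rewrite big_split/=; congr (_ + _); last first.
  rewrite exchange_big/=; apply: eq_bigr => u _; apply: eq_bigl => c.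
  by rewrite -ltnNge.
rewrite -mulr_sumr -card_le mulr_suml; apply: eq_bigr => c _.
by rewrite mul1r; apply: eq_bigr => u _; rewrite prod_le mulrCA.
Qed.

Lemma two_point_ge (R : realType) (q a tau t l W : R) :
  0 <= q -> 0 <= a -> 0 <= tau <= 1 -> 0 <= l -> 0 <= W ->
  (1 - tau) `^ q * a `^ q * Num.min l (tau `^ q * W) <=
  `|t - a| `^ q * l + `|t| `^ q * W.
Proof.
move=> q0 a0 /andP[tau0 tau1] l0 W0.
have tau1' : 0 <= 1 - tau by rewrite subr_ge0.
rewrite -powRM//.
have [ta|ta] := leP `|t| (tau * a).
  apply: (@le_trans _ _ (`|t - a| `^ q * l)); last first.
    by rewrite lerDl mulr_ge0 ?powR_ge0.
  apply: ler_pM; rewrite ?powR_ge0 ?ge_min ?lexx//.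
    by rewrite le_min l0 mulr_ge0 ?powR_ge0.
  apply: ge0_ler_powR; rewrite ?nnegrE ?mulr_ge0//.
  rewrite distrC mulrBl mul1r (le_trans _ (lerB_dist _ _))//.
  by rewrite (ger0_norm a0) lerB.
apply: (@le_trans _ _ (`|t| `^ q * W)); last first.
  by rewrite lerDr mulr_ge0 ?powR_ge0.
apply: (@le_trans _ _ (a `^ q * (tau `^ q * W))).
  apply: ler_pM; rewrite ?powR_ge0 ?ge_min ?lexx ?orbT//.
    by rewrite le_min l0 mulr_ge0 ?powR_ge0.
  by apply: ge0_ler_powR; rewrite ?nnegrE ?mulr_ge0// ler_piMl// gerBl.
rewrite mulrA ler_wpM2r// -powRM// mulrC.
by apply: ge0_ler_powR; rewrite ?nnegrE ?mulr_ge0// ltW.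
Qed.

(* The index z is that of the last spike: z.+1 is the number of spikes. *)
Section permutation_risk_bound.
Context {R : realType}.
Local Notation T := (measurableTypeR R).
Variables (n : nat) (z : 'I_n) (a A e q tau : R).
Hypotheses (a0 : 0 <= a) (A0 : 0 <= A) (q0 : 0 <= q) (tau01 : 0 <= tau <= 1).
Let N : R := (n - z.+1)%:R.
Let P0 := gaussian_vector [tuple of nseq n (0 : R)].
Let L (x : T) := gauss_lr 0 a x.
Let M (x : T) : R := if L x <= A then L x else 0.
Hypotheses (N0 : 0 < N) (e0 : 0 < e).
Hypothesis eM : (\int[normal_prob 0 1]_x (M x)%:E = e%:E)%E.
Hypothesis Ah : 2 * A <= tau `^ q / z.+1%:R * (N * e).
Variables (v : n.-tuple R) (t : n.-tuple T -> n.-tuple T).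
Hypothesis vE : forall c, tnth v c = if (c <= z)%N then a else 0.
Hypothesis mt : measurable_fun [set: n.-tuple T] t.

Let L0 x : 0 <= L x. Proof. exact: expR_ge0. Qed.

Let mL : measurable_fun [set: T] L. Proof. exact: measurable_gauss_lr. Qed.

Let mM : measurable_fun [set: T] M.
Proof.
apply: measurable_fun_ifT => //.
by apply: (measurable_fun_ler mL); exact: measurable_cst.
Qed.

Let M0 x : 0 <= M x. Proof. by rewrite /M; case: ifP. Qed.

Let MA x : M x <= A. Proof. by rewrite /M; case: ifP. Qed.

Let ML x : M x <= L x. Proof. by rewrite /M; case: ifP. Qed.

Let W (u : 'S_n) (x : n.-tuple T) :=
  \prod_(c < n | (c < z)%N) L (tnth x (u c)) *
  Num.min (M (tnth x (u z)))
    (tau `^ q / z.+1%:R * \sum_(d < n | (z < d)%N) M (tnth x (u d))).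

(** The product is the density of N(permute v s, I_n) with respect to pure noise: null coordinates
    contribute a factor 1. *)
Let H (s : 'S_n) (x : n.-tuple T) :=
  lq_loss q (t x) (permute v s) * \prod_(c < n | (s c <= z)%N) L (tnth x c).

(** After the exchange of labels, [two_point_ge] applies to each labelling, with the sum over null
    positions divided by the number of spikes as [W]. Truncation can only lower the minimum. *)
Let sum_H_ge (x : n.-tuple T) :
  \sum_(u : 'S_n) n%:R^-1 * (z.+1%:R * ((1 - tau) `^ q * a `^ q)) * W u x <=
  \sum_(s : 'S_n) H s x.
Proof.
pose F i := `|tnth (t x) i - a| `^ q; pose G i := `|tnth (t x) i| `^ q.
pose l i := L (tnth x i).
have -> : \sum_(s : 'S_n) H s x = n%:R^-1 *
    \sum_(u : 'S_n) (\sum_(c < n) (if (c <= z)%N then F (u c) else G (u c))) *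
                    \prod_(c < n | (c <= z)%N) l (u c).
  rewrite mulr_sumr.
  (* [permute v s] sends coordinates to positions, whereas a labelling [u] sends positions to
     coordinates; hence the inverse. *)
  rewrite (@reindex_inj _ _ _ _ (fun s : 'S_n => s^-1)%g _ _ invg_inj)/=.
  apply: eq_bigr => u _; rewrite /H /lq_loss -mulrA; congr (_ * (_ * _)).
    rewrite (reindex_inj (@perm_inj _ u)); apply: eq_bigr => c _.
    rewrite /permute tnth_mktuple permK vE /F /G.
    by case: ifP => // _; rewrite subr0.
  rewrite (reindex_inj (@perm_inj _ u)).
  by apply: eq_bigl => c; rewrite permK.
rewrite sum_perm_spike mulr_sumr; apply: ler_sum => u _.
rewrite -mulrA ler_wpM2l ?invr_ge0 ?ler0n// /W mulrCA ler_wpM2l//.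
  by apply: prodr_ge0 => c _; exact: L0.
have k0 : 0 < z.+1%:R :> R by rewrite ltr0n.
have k_neq0 := lt0r_neq0 k0.
set w := \sum_(d < n | _) l (u d).
have w0 : 0 <= w by apply: sumr_ge0 => d _; exact: L0.
rewrite [leRHS](_ : _ = z.+1%:R * (F (u z) * l (u z) + G (u z) * (w / z.+1%:R)));
  last by field.
rewrite -[leLHS]mulrA ler_wpM2l ?ler0n//.
have wk0 : 0 <= w / z.+1%:R by rewrite divr_ge0 ?ler0n.
apply: le_trans (two_point_ge (tnth (t x) (u z)) q0 a0 tau01
  (L0 (tnth x (u z))) wk0).
rewrite ler_wpM2l ?mulr_ge0 ?powR_ge0// le_min !ge_min ML/=.
apply/orP; right; rewrite -mulrA ler_wpM2l ?powR_ge0//.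
by rewrite mulrC ler_wpM2r ?invr_ge0 ?ler0n// ler_sum.
Qed.

Let measurable_loss s :
  measurable_fun [set: n.-tuple T] (fun x => lq_loss q (t x) (permute v s)).
Proof.
apply: measurable_funM => //; apply: measurable_sum => i.
apply: (measurableT_comp (measurable_powR q)); apply: measurableT_comp => //.
apply: measurable_funB => //.
exact: (measurableT_comp (@measurable_tnth _ T n i) mt).
Qed.

Let loss_ge0 s x : 0 <= lq_loss q (t x) (permute v s).
Proof.
by rewrite mulr_ge0 ?invr_ge0 ?ler0n// sumr_ge0// => i _; exact: powR_ge0.
Qed.

Let mLn c : measurable_fun [set: n.-tuple T] (fun x => L (tnth x c)).
Proof. by apply: (measurableT_comp mL); exact: measurable_tnth. Qed.

Let mMn c : measurable_fun [set: n.-tuple T] (fun x => M (tnth x c)).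
Proof. by apply: (measurableT_comp mM); exact: measurable_tnth. Qed.

Let mH s : measurable_fun [set: n.-tuple T] (H s).
Proof. by apply: measurable_funM => //; exact: measurable_prod_cond. Qed.

Let H_ge0 s x : 0 <= H s x.
Proof. by rewrite mulr_ge0// prodr_ge0. Qed.

Let integral_loss s : (\int[gaussian_vector (permute v s)]_x
    (lq_loss q (t x) (permute v s))%:E = \int[P0]_x (H s x)%:E)%E.
Proof.
apply: (etrans (@ge0_integral_gaussian_vector_lr _ _ [tuple of nseq n 0]
  (permute v s) (fun x => (lq_loss q (t x) (permute v s))%:E) _ _)).
- exact/measurable_EFinP.
- by move=> x; rewrite lee_fin.
apply: eq_integral => x _; rewrite -EFinM; congr (_ * _)%:E.
rewrite [RHS]big_mkcond/=; apply: eq_bigr => i _.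
rewrite tnth_nseq tnth_mktuple vE; case: ifP => // _.
by rewrite /gauss_lr subrr mul0r subrr mul0r subrr expR0.
Qed.

Let mW u : measurable_fun [set: n.-tuple T] (W u).
Proof.
apply: measurable_funM; first exact: measurable_prod_cond.
apply: measurable_minr => //; apply: measurable_funM => //.
exact: measurable_sum_cond.
Qed.

Let W_ge0 u x : 0 <= W u x.
Proof.
rewrite mulr_ge0 ?prodr_ge0// le_min M0 mulr_ge0 ?sumr_ge0//.
by rewrite divr_ge0 ?powR_ge0 ?ler0n.
Qed.

Lemma permutation_risk_ge :
  ((n%:R^-1 * (z.+1%:R * ((1 - tau) `^ q * a `^ q)) * (e - A / N))%:E <=
   permutation_risk q v t)%E.
Proof.
set K := _^-1 * _.
have K0 : 0 <= K by rewrite !mulr_ge0 ?invr_ge0 ?powR_ge0 ?ler0n.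
have -> : permutation_risk q v t =
    ((n`!%:R^-1)%:E * \int[P0]_x (\sum_(s : 'S_n) H s x)%:E)%E.
  congr (_ * _)%E; rewrite ge0_integral_sum_cond//.
  by apply: eq_bigr => s _; exact: integral_loss.
have mKW u : measurable_fun [set: n.-tuple T] (fun x => K * W u x).
  exact: measurable_funM.
apply: (@le_trans _ _
    ((n`!%:R^-1)%:E * \int[P0]_x (\sum_(u : 'S_n) K * W u x)%:E)%E); last first.
  apply: lee_wpmul2l; first by rewrite lee_fin invr_ge0 ler0n.
  apply: ge0_le_integral => //.
  - by move=> x _; rewrite lee_fin sumr_ge0// => u _; rewrite mulr_ge0.
  - by apply/measurable_EFinP; exact: measurable_sum_cond.
  - by apply/measurable_EFinP; exact: measurable_sum_cond.
  - by move=> x _; rewrite lee_fin; exact: sum_H_ge.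
rewrite ge0_integral_sum_cond//; last by move=> u x; rewrite mulr_ge0.
apply: (@le_trans _ _
    ((n`!%:R^-1)%:E * \sum_(u : 'S_n) (K * (e - A / N))%:E)%E).
  rewrite sumEFin sumr_const -EFinM lee_fin -[X in _ <= _ * X]mulr_natl mulrA.
  by rewrite card_Sn mulVf ?mul1r// pnatr_eq0 -lt0n fact_gt0.
apply: lee_wpmul2l; first by rewrite lee_fin invr_ge0 ler0n.
apply: lee_sum => u _.
under eq_integral do rewrite EFinM.
rewrite ge0_integralZl_EFin//; last 2 first.
- by move=> x _; rewrite lee_fin.
- exact/measurable_EFinP.
rewrite EFinM; apply: lee_wpmul2l; first by rewrite lee_fin.
exact: (integral_min_truncated_ge u a mM M0 MA eM N0 e0 Ah).
Qed.

End permutation_risk_bound.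

(** * Mean of the truncated likelihood ratio *)

Lemma truncated_likelihood_mean (R : realType) (a al lam : R) : 0 <= lam ->
  exists2 e : R, (\int[normal_prob 0 1]_x
      (if gauss_lr 0 a x <= expR al then gauss_lr 0 a x else 0)%:E = e%:E)%E &
    1 - expR (lam * ((1 + lam) * a ^+ 2 / 2 - al)) <= e.
Proof.
(* Chernoff bound: L <= L ^ (1 + lam) / A ^ lam where L exceeds A = expR al, and
   L ^ (1 + lam) is a likelihood ratio up to a constant factor. *)
move=> lam0; set L := gauss_lr 0 a.
pose M x := if L x <= expR al then L x else 0.
(* These make [expR c * gauss_lr 0 b x] equal to [L x ^ (1 + lam) / expR al ^ lam], whose integral
   is [expR c]. *)
pose b := (1 + lam) * a; pose c := lam * ((1 + lam) * a ^+ 2 / 2 - al).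
have mL : measurable_fun [set: measurableTypeR R] L by exact: measurable_gauss_lr.
have mM : measurable_fun [set: measurableTypeR R] M.
  apply: measurable_fun_ifT => //.
  by apply: (measurable_fun_ler mL); exact: measurable_cst.
have M0 x : 0 <= M x by rewrite /M; case: ifP => // _; exact: expR_ge0.
have ML x : M x <= L x by rewrite /M; case: ifP => // _; exact: expR_ge0.
have LM x : L x <= M x + expR c * gauss_lr 0 b x.
  rewrite /M; case: ifPn => [_|].
    by rewrite lerDl mulr_ge0 ?expR_ge0.
  rewrite -ltNge /L /gauss_lr ltr_expR add0r -expRD ler_expR => alL.
  set w := _ - _ in alL *.
  rewrite (_ : _ + _ = w + lam * (w - al)); last by rewrite /w /c /b; field.
  by rewrite lerDl mulr_ge0// subr_ge0 ltW.
have iM_le1 : (\int[normal_prob 0 1]_x (M x)%:E <= 1)%E.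
  rewrite -(integral_gauss_lr 0 a); apply: ge0_le_integral => //.
  - by move=> x _; rewrite lee_fin.
  - exact/measurable_EFinP.
  - exact/measurable_EFinP.
  - by move=> x _; rewrite lee_fin.
have iM_ge0 : (0 <= \int[normal_prob 0 1]_x (M x)%:E)%E.
  by apply: integral_ge0 => x _; rewrite lee_fin.
have iM_fin : (\int[normal_prob 0 1]_x (M x)%:E)%E \is a fin_num.
  by rewrite ge0_fin_numE// (le_lt_trans iM_le1)// ltry.
exists (fine (\int[normal_prob 0 1]_x (M x)%:E)%E); first by rewrite fineK.
rewrite -lee_fin fineK// EFinB leeBlDr//.
rewrite -(integral_gauss_lr 0 a).
apply: (@le_trans _ _ (\int[normal_prob 0 1]_x
    ((M x)%:E + (expR c)%:E * (gauss_lr 0 b x)%:E))%E).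
  apply: ge0_le_integral => //.
  - by move=> x _; rewrite lee_fin expR_ge0.
  - exact/measurable_EFinP.
  - apply: emeasurable_funD; first exact/measurable_EFinP.
    apply: emeasurable_funM => //; apply/measurable_EFinP.
    exact: measurable_gauss_lr.
  - by move=> x _; rewrite lee_fin LM.
rewrite ge0_integralD//; last 4 first.
- by move=> x _; rewrite lee_fin.
- exact/measurable_EFinP.
- by move=> x _; rewrite mule_ge0// lee_fin expR_ge0.
- apply: emeasurable_funM => //; apply/measurable_EFinP.
  exact: measurable_gauss_lr.
rewrite ge0_integralZl_EFin ?expR_ge0//; last 2 first.
- by move=> x _; rewrite lee_fin expR_ge0.
- by apply/measurable_EFinP; exact: measurable_gauss_lr.
by rewrite (integral_gauss_lr 0 b) mule1.
Qed.

(** * The threshold [mu], its limits and the non-asymptotic Bayes risk bound *)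

(** Positivity of [mu p r] forces the radicand to be positive; on negative arguments [Num.sqrt] is 0
    and the identity would fail. *)
Lemma expR_mu (R : realType) (p r : R) : 0 < r -> 0 < mu p r ->
  expR (mu p r ^+ 2 / 2) = (r `^ p)^-1.
Proof.
move=> r0; rewrite /mu sqrtr_gt0 => m0.
rewrite sqr_sqrtr ?(ltW m0)// mulrAC divff ?pnatr_eq0// !mul1r lnK//.
by rewrite posrE invr_gt0 powR_gt0.
Qed.

Lemma powRN_cvg0 (R : realType) (c : R) (f : nat -> R) : 0 < c ->
  f n @[n --> \oo] --> +oo -> f n `^ (- c) @[n --> \oo] --> 0.
Proof.
move=> c0 foo; apply/cvgr0Pnorm_le => e e0.
have K0 : 0 < e^-1 `^ c^-1 by rewrite powR_gt0// invr_gt0.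
have /cvgryPge/(_ (e^-1 `^ c^-1)) := foo.
apply: filterS => n Kf; rewrite ger0_norm ?powR_ge0// powRN invf_ple; last 2 first.
- by rewrite posrE powR_gt0// (lt_le_trans K0).
- by rewrite posrE.
rewrite (_ : e^-1 = (e^-1 `^ c^-1) `^ c); last first.
  by rewrite -powRrM mulVf ?gt_eqF// powRr1// invr_ge0 ltW.
by apply: ge0_ler_powR; rewrite ?nnegrE ?(ltW c0) ?(ltW K0)// (le_trans _ Kf)// ltW.
Qed.

Lemma powR_continuous_gt0 (R : realType) (q x : R) : 0 < x ->
  {for x, continuous (@powR R ^~ q)}.
Proof.
move=> x0; apply: differentiable_continuous; apply/derivable1_diffP.
by apply: derivable_powR; rewrite in_itv/= x0.
Qed.

Lemma mu_cvgy (R : realType) (p : R) (r : nat -> R) : 0 < p ->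
  (forall n, 0 < r n) -> r n @[n --> \oo] --> 0 ->
  mu p (r n) @[n --> \oo] --> +oo.
Proof.
move=> p0 r0 rcvg; apply/cvgryPge => K.
have rp : r n `^ p @[n --> \oo] --> 0.
  by have /cvg_at_rightP := powR_cvg0 p0; apply.
have : \forall n \near \oo, r n `^ p <= expR (- (K ^+ 2 / 2)).
  by apply: (cvgr_le _ rp); exact: expR_gt0.
apply: filterS => n rn.
have rp0 : 0 < r n `^ p by rewrite powR_gt0.
rewrite /mu (le_trans (ler_norm K))// -sqrtr_sqr ler_wsqrtr//.
rewrite mulrC -ler_pdivrMr// -ler_expR lnK ?posrE ?divr_gt0// div1r.
by rewrite -[leLHS]invrK lef_pV2 ?posrE ?invr_gt0 ?expR_gt0// -expRN.
Qed.

(* tau ^ q = mu ^ (- p) vanishes as mu grows, and still allows the truncation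
   level A = exp (mu ^ 2 / 2 - 3) <= 1 / (8 r ^ p) in permutation_risk_ge. The
   exponent eps / (2 (1 - eps)) is the Chernoff parameter lam for which
   (1 + lam) (1 - eps) = 1 - eps / 2. *)
Lemma permutation_bayes_risk_spike_ge (R : realType) (p q eps r : R) (n : nat) :
  let m := mu p r in
  let s := sparsity p n r in
  let delta := expR (eps / (2 * (1 - eps)) * (3 - eps * m ^+ 2 / 4)) in
  0 < p -> 0 < q -> 0 < eps < 1 -> 0 < r ->
  2 <= m -> 1 <= s -> delta <= 2^-1 ->
  (((1 - s^-1) * (1 - m `^ (- (p / q))) `^ q * (1 - delta) * (1 - m `^ (- p)) *
    Num.sqrt (1 - eps) `^ q * (m `^ (q - p) * r `^ p))%:E <=
   permutation_bayes_risk q (spike_vector p eps n r))%E.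
Proof.
move=> m s delta p0 q0 /andP[eps0 eps1] r0 m2 s1 delta2.
have m0 : 0 < m by lra.
have rp0 : 0 < r `^ p by rewrite powR_gt0.
have mp0 : 0 < m `^ p by rewrite powR_gt0.
have mp1 : 1 <= m `^ p by rewrite -[leLHS](powRr0 m) ler_powR ?ltW//; lra.
have expm := expR_mu r0 m0; rewrite -/m in expm.
have rp3 : 3 * r `^ p <= 1.
  rewrite -ler_pdivlMr// div1r -expm (le_trans _ (expR_ge1Dx _))//.
  by rewrite expr2; nra.
have sE : s * m `^ p = n%:R * r `^ p by rewrite /s /sparsity divfK ?gt_eqF.
have n0 : 0 < n%:R :> R.
  rewrite -(pmulr_lgt0 _ rp0) -sE mulr_gt0//; lra.
(* At most a third of the coordinates are spikes, so at least [2 n / 3] are null. *)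
have sn : 3 * s <= n%:R.
  have : s <= s * m `^ p by rewrite ler_peMr//; lra.
  by rewrite sE => /(ler_wpM2l (ler0n R 3)) /le_trans; apply; nra.
pose k := Num.truncn s.
have s_ge0 : 0 <= s by lra.
have /andP[ks sk] := truncn_itv s_ge0; rewrite -/k in ks sk.
have k0 : (0 < k)%N by rewrite /k truncn_gt_nat.
have kn : (k <= n)%N by rewrite -(ler_nat R); lra.
have zn : (k.-1 < n)%N by rewrite prednK.
(* Positions start at 0, so the last of the [k] spikes is at [k.-1]. *)
pose z := Ordinal zn; have zk : z.+1 = k by rewrite /z/= prednK.
have kR0 : 1 <= k%:R :> R by rewrite ler1n.
have NE : (n - z.+1)%:R = n%:R - k%:R :> R by rewrite zk natrB.
have eps1' : 0 < 1 - eps by rewrite subr_gt0.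
pose a := Num.sqrt (1 - eps) * m.
have a0 : 0 <= a by rewrite mulr_ge0 ?sqrtr_ge0// ltW.
pose lam := eps / (2 * (1 - eps)).
have lam0 : 0 <= lam by rewrite divr_ge0 ?mulr_ge0 ?(ltW eps0) ?(ltW eps1').
have [e eM delta_e] := truncated_likelihood_mean a (m ^+ 2 / 2 - 3) lam0.
have expE : lam * ((1 + lam) * a ^+ 2 / 2 - (m ^+ 2 / 2 - 3)) =
    eps / (2 * (1 - eps)) * (3 - eps * m ^+ 2 / 4).
  rewrite /a exprMn sqr_sqrtr ?(ltW eps1')// /lam; field.
  by rewrite gt_eqF.
rewrite expE -/delta in delta_e.
have e2 : 2^-1 <= e by lra.
set A := expR _ in eM.
have A0 : 0 < A by exact: expR_gt0.
have A8 : 8 * (A * r `^ p) <= 1.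
  rewrite /A expRB expm mulrAC mulVf ?gt_eqF// mul1r.
  rewrite ler_pdivrMr ?expR_gt0// mul1r.
  have -> : expR 3 = expR 1 ^+ 3 :> R by rewrite -expRM_natl mulr1.
  have : 2 <= expR 1 :> R by rewrite (le_trans _ (expR_ge1Dx _)).
  by move=> h; rewrite (_ : 8 = 2 ^+ 3) ?lerXn2r ?nnegrE ?expR_ge0//; ring.
pose tau := m `^ (- (p / q)).
have tauq : tau `^ q = m `^ (- p).
  by rewrite /tau -powRrM mulNr divfK ?gt_eqF.
have tau01 : 0 <= tau <= 1.
  rewrite powR_ge0/= -[leRHS](powRr0 m) ler_powR ?oppr_le0 ?divr_ge0 ?ltW//; lra.
have kappaE : m `^ (- p) = (m `^ p)^-1 by rewrite powRN.
have kappa0 : 0 < m `^ (- p) by rewrite powR_gt0.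
have kappa1 : m `^ (- p) <= 1 by rewrite kappaE invf_le1.
(* Since [k <= s], it suffices that [2 * A * s * m]^ p = 2 * A * n * r [^ p] is at most the number
   of null positions times [e]: the former is at most [n / 4], the latter at least [n / 3]. *)
have Ah : 2 * A <= tau `^ q / z.+1%:R * ((n - z.+1)%:R * e).
  rewrite tauq kappaE NE zk -invfM [leRHS]mulrC ler_pdivlMr; last first.
    by rewrite mulr_gt0//; lra.
  apply: (@le_trans _ _ (2 * A * (s * m `^ p))).
    by rewrite (mulrC (m `^ p)) ler_wpM2l ?ler_wpM2r// ?mulr_ge0// ltW.
  rewrite sE; nra.
(* Weakening [Ah] by the factors 2 and [1 / k] shows that the second-moment error is a vanishing
   fraction of [e]. *)
have AN : A / (n - z.+1)%:R <= m `^ (- p) * e.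
  have N0 : 0 < (n - z.+1)%:R :> R by rewrite NE; lra.
  rewrite ler_pdivrMr// -mulrA (mulrC e).
  have : tau `^ q / z.+1%:R * ((n - z.+1)%:R * e) <=
      m `^ (- p) * ((n - z.+1)%:R * e).
    have e_ge0 : 0 <= e by lra.
    have kR_gt0 : 0 < k%:R :> R by lra.
    rewrite tauq zk ler_wpM2r ?mulr_ge0 ?ler0n//.
    by rewrite ler_pdivrMr// ler_peMr ?(ltW kappa0).
  move=> /(le_trans Ah); apply: le_trans.
  by rewrite ler_peMl ?(ltW A0)// ler1n.
apply: le_ereal_inf_tmp => _ [t mt <-].
have vE c : tnth (spike_vector p eps n r) c = if (c <= z)%N then a else 0.
  by rewrite tnth_mktuple -/s -/k -zk ltnS.
have N0 : 0 < (n - z.+1)%:R :> R by rewrite NE; lra.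
have e0 : 0 < e by lra.
apply: le_trans (permutation_risk_ge a0 (ltW A0) (ltW q0) tau01 N0 e0 eM Ah vE mt).
rewrite lee_fin zk.
have -> : m `^ (q - p) * r `^ p = n%:R^-1 * (s * m `^ q).
  rewrite powRB ?(gt_eqF m0) ?implybT//.
  rewrite (_ : r `^ p = n%:R^-1 * (s * m `^ p)); last first.
    by rewrite sE mulKf ?gt_eqF.
  by field; rewrite !gt_eqF.
rewrite powRM ?sqrtr_ge0 ?(ltW m0)// -/tau.
set T1 := (1 - tau) `^ q; set T2 := Num.sqrt _ `^ q; set T3 := m `^ q.
have T10 : 0 <= T1 by exact: powR_ge0.
have T20 : 0 <= T2 by exact: powR_ge0.
have T30 : 0 <= T3 by exact: powR_ge0.
(* The factor [1 - s^-1] pays for rounding: [(1 - s^-1) * s = s - 1] is below the floor [k] of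
   [s]. *)
rewrite [leLHS](_ : _ = n%:R^-1 * ((s - 1) * (T1 * (T2 * T3))) *
    ((1 - delta) * (1 - m `^ (- p)))); last first.
  by field; rewrite !gt_eqF//; lra.
apply: ler_pM.
- by rewrite !mulr_ge0 ?invr_ge0 ?ler0n//; lra.
- by rewrite mulr_ge0//; lra.
- rewrite ler_wpM2l ?invr_ge0 ?ler0n// ler_wpM2r ?mulr_ge0//.
  by rewrite lerBlDr natr1 ltW.
- apply: (@le_trans _ _ (e * (1 - m `^ (- p)))).
    by rewrite ler_wpM2r//; lra.
  by rewrite mulrBr mulr1 (mulrC e) lerB// -zk.
Qed.

(** * Passage to the limit *)

Theorem lemma2p1 (R : realType) (p q : R) (p_gt0 : 0 < p)
    (q_ge : Num.max p 1 <= q) :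
  exists c : R -> R, c eps @[eps --> 0^'+] --> 0 /\
    forall r : nat -> R,
      (forall n, 0 < r n) ->
      r n @[n --> \oo] --> 0 ->
      sparsity p n (r n) @[n --> \oo] --> +oo ->
      forall eps : R, 0 < eps < 1 ->
        exists o : nat -> R, o n @[n --> \oo] --> 0 /\
          \forall n \near \oo,
            (((1 - o n) * (1 - c eps) * (mu p (r n) `^ (q - p) * r n `^ p))%:E
              <= permutation_bayes_risk q
                   (spike_vector p eps n (r n)))%E.
Proof.
have q_gt0 : 0 < q by rewrite (lt_le_trans p_gt0)// (le_trans _ q_ge)// le_max lexx.
(* The only loss that persists as [n] grows comes from the spike height, [Num.sqrt (1 - eps)] times
   the threshold, raised to the power [q]. *)
exists (fun eps => 1 - Num.sqrt (1 - eps) `^ q); split.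
  rewrite -[X in _ --> X](subrr (1 : R)); apply: cvgB; first exact: cvg_cst.
  apply: cvg_at_right_filter.
  have cts : {for 0, continuous (fun eps : R => Num.sqrt (1 - eps) `^ q)}.
    apply: (@continuous_comp _ _ _ (fun eps : R => Num.sqrt (1 - eps))
              (@powR R ^~ q)).
      apply: (@continuous_comp _ _ _ (fun eps : R => 1 - eps) (@Num.sqrt R)).
        by apply: cvgB; [exact: cvg_cst|exact: cvg_id].
      exact: sqrt_continuous.
    by apply: powR_continuous_gt0; rewrite subr0 sqrtr1.
  by move: cts; rewrite /prop_for /continuous_at subr0 sqrtr1 powR1.
move=> r r0 rcvg scvg eps eps01; have /andP[eps0 eps1] := eps01.
pose m n := mu p (r n); pose s n := sparsity p n (r n).
pose lam := eps / (2 * (1 - eps)).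
pose delta n := expR (lam * (3 - eps * m n ^+ 2 / 4)).
have moo : m n @[n --> \oo] --> +oo by exact: mu_cvgy.
have lam0 : 0 < lam by rewrite divr_gt0// mulr_gt0// subr_gt0.
have delta_cvg : delta n @[n --> \oo] --> 0.
  apply/cvgr0Pnorm_le => e e0.
  (* [delta n <= e] amounts to [K <= m n ^+ 2]; the maximum with 1 below lets [K <= m n] imply
     it. *)
  pose K := 4 * (3 - ln e / lam) / eps.
  have := moo; move=> /cvgryPge /(_ (Num.max 1 K)); apply: filterS => n.
  rewrite ge_max => /andP[m1 mK]; rewrite ger0_norm ?expR_ge0//.
  rewrite -[leRHS](lnK e0) ler_expR -(divfK (lt0r_neq0 lam0) (ln e)) mulrC.
  rewrite ler_pM2r//.
  have : K <= m n ^+ 2.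
    by rewrite (le_trans mK)// expr2 ler_peMr// (le_trans _ m1).
  rewrite /K ler_pdivrMr//; lra.
have tau_cvg : m n `^ (- (p / q)) @[n --> \oo] --> 0.
  by apply: powRN_cvg0 => //; rewrite divr_gt0.
have kappa_cvg : m n `^ (- p) @[n --> \oo] --> 0 by exact: powRN_cvg0.
have sV_cvg : (s n)^-1 @[n --> \oo] --> 0.
  apply/gtr0_cvgV0 => //.
  by have /cvgryPgt := scvg; exact.
(* One minus the product of the factors of the non-asymptotic bound that tend to 1. *)
exists (fun n => 1 - (1 - (s n)^-1) * (1 - m n `^ (- (p / q))) `^ q *
                     (1 - delta n) * (1 - m n `^ (- p))); split.
  have cvg1B (u : nat -> R) : u n @[n --> \oo] --> 0 ->
      1 - u n @[n --> \oo] --> (1 : R).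
    move=> ucvg; rewrite -[X in _ --> X](subr0 (1 : R)).
    by apply: cvgB => //; exact: cvg_cst.
  rewrite -[X in _ --> X](subrr (1 : R)); apply: cvgB; first exact: cvg_cst.
  rewrite -[X in _ --> X](mulr1 (1 : R)); apply: cvgM; last exact: cvg1B.
  rewrite -[X in _ --> X](mulr1 (1 : R)); apply: cvgM; last exact: cvg1B.
  rewrite -[X in _ --> X](mulr1 (1 : R)); apply: cvgM; first exact: cvg1B.
  have {2}<- : (1 : R) `^ q = 1 by rewrite powR1.
  apply: (cvg_comp _ (@powR R ^~ q) (cvg1B _ tau_cvg)).
  by apply: powR_continuous_gt0; exact: ltr01.
have m2 : \forall n \near \oo, 2 <= m n by have /cvgryPge := moo; exact.
have s1 : \forall n \near \oo, 1 <= s n by have /cvgryPge := scvg; exact.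
have d2 : \forall n \near \oo, delta n <= 2^-1.
  by apply: (cvgr_le _ delta_cvg); rewrite invr_gt0.
near=> n; rewrite !subKr.
apply: permutation_bayes_risk_spike_ge => //.
- by near: n; exact: m2.
- by near: n; exact: s1.
- by near: n; exact: d2.
Unshelve. all: by end_near. Qed.
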